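(* Let $S$ be a subtractive semidomain such that $ab\in (a^2,b^2)$ for all $a,b\in S$. Then the following statements are equivalent: (1) $S$ is a Prüfer semiring. (2) Each nonzero finitely generated ideal of $S$ is a cancellation ideal. (3) $[IJ:I]=J$ for all finitely generated ideals $I$ and $J$ of $S$ with $I$ nonzero. (4) $S$ is a Gaussian semiring.
   Context: A semiring is a set $S$ with operations $+,\cdot$ such that $(S,+)$ is a commutative monoid with identity $0$, $(S,\cdot)$ is a commutative monoid with identity $1\neq 0$, multiplication distributes over addition, and $s\cdot 0=0$ for all $s\in S$. An ideal of $S$ is a nonempty subset $I\subseteq S$ such that $a,b\in I$ and $s\in S$ imply $a+b, sa\in I$; $(a_1,\dots,a_n)$ denotes the ideal generated by $a_1,\dots,a_n$. An ideal $I$ is subtractive if $a+b\in I$ and $a\in I$ imply $b\in I$; a semiring is subtractive if all its ideals are subtractive. For ideals $I,J$: $IJ$ is the set of finite sums $\sum a_ib_i$ with $a_i\in I$, $b_i\in J$, and $[I:J]=\{s\in S: sJ\subseteq I\}$. A nonzero ideal $I$ is a cancellation ideal if $IJ=IK$ implies $J=K$ for all ideals $J,K$ of $S$. An element $s\in S$ is multiplicatively cancellable (MC) if $sb=sc$ implies $b=c$ for all $b,c\in S$; $S$ is a semidomain if every nonzero element of $S$ is MC. For $f\in S[X]$, the content $c(f)$ is the ideal of $S$ generated by the coefficients of $f$; $S$ is Gaussian if $c(fg)=c(f)c(g)$ for all $f,g\in S[X]$. The total quotient semiring $Q(S)$ is the localization of $S$ at the set $M$ of its MC elements: the set of classes $a/b$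 of pairs $(a,b)\in S\times M$ under $(a,b)\sim(c,d)$ iff $tad=tbc$ for some $t\in M$, with $a/b+c/d=(ad+bc)/(bd)$ and $(a/b)(c/d)=(ac)/(bd)$; $S$ is viewed inside $Q(S)$ via $s\mapsto s/1$. A fractional ideal of $S$ is a nonempty subset $I\subseteq Q(S)$ closed under addition and under multiplication by elements of $S$, such that $dI\subseteq S$ for some MC element $d\in S$. The product of fractional ideals is $IJ=\{a_1b_1+\cdots+a_nb_n: a_i\in I,\ b_i\in J\}$. A fractional ideal (in particular an ideal) $I$ of $S$ is invertible if $IJ=S$ for some fractional ideal $J$ of $S$. A semiring $S$ is a Prüfer semiring if every nonzero finitely generated ideal of $S$ is invertible. *)

(* Defs.v *)
From HB Require Import structures.
From mathcomp Require Import all_boot all_order all_algebra.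
From mathcomp Require Import generic_quotient.
From mathcomp Require Import boolp classical_sets.
From mathcomp Require Import ring.

Set Implicit Arguments.
Unset Strict Implicit.
Unset Printing Implicit Defensive.

Import GRing.Theory.
Local Open Scope ring_scope.
Local Open Scope quotient_scope.
Local Open Scope classical_set_scope.

Section Ideals.
Variable S : comNzSemiRingType.
Implicit Types (I J K A : set S) (s : S) (f g : {poly S}).

Definition is_ideal I : Prop :=
  [/\ I !=set0,
      forall a b, I a -> I b -> I (a + b)
    & forall s a, I a -> I (s * a)].

Definition ideal_gen A : set S := smallest is_ideal A.

Definition fin_gen I : Prop := exists r : seq S, I = ideal_gen [set` r].

Definition subtractive_ideal I : Prop :=
  forall a b, I (a + b) -> I a -> I b.

Definition subtractive_semiring : Prop :=
  forall I, is_ideal I -> subtractive_ideal I.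

(* Stated for arbitrary sets: also used for fractional ideals, with the total
   quotient semiring as ambient semiring. *)
Definition ideal_mul I J : set S :=
  [set x | exists n (a b : 'I_n -> S),
     [/\ forall i, I (a i), forall i, J (b i) & x = \sum_(i < n) a i * b i]].

Definition residual I J : set S := [set s | forall x, J x -> I (s * x)].

Definition cancellation_ideal I : Prop :=
  [/\ is_ideal I, I <> [set 0]
    & forall J K, is_ideal J -> is_ideal K ->
        ideal_mul I J = ideal_mul I K -> J = K].

Definition mult_cancellable s : Prop := forall b c, s * b = s * c -> b = c.

Definition semidomain : Prop := forall s, s != 0 -> mult_cancellable s.

Definition content f : set S := ideal_gen (range (fun i : nat => f`_i)).

Definition gaussian_semiring : Prop :=
  forall f g, content (f * g) = ideal_mul (content f) (content g).

End Ideals.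

Section TotalQuotient.
Variable S : comNzSemiRingType.

Record mc_elt := MCElt
  { mc_val :> S; mc_valP : `[< mult_cancellable mc_val >] }.
HB.instance Definition _ := [isSub for mc_val].
HB.instance Definition _ := [Choice of mc_elt by <:].

Lemma mc_eltP (d : mc_elt) : mult_cancellable (mc_val d).
Proof. exact/asboolP/mc_valP. Qed.

Lemma mc1_subproof : `[< mult_cancellable (1 : S) >].
Proof. by apply/asboolP => b c; rewrite !mul1r. Qed.

Lemma mcM_subproof (d e : mc_elt) :
  `[< mult_cancellable (mc_val d * mc_val e) >].
Proof.
by apply/asboolP => b c; rewrite -!mulrA => /mc_eltP /mc_eltP.
Qed.

Definition mc1 : mc_elt := MCElt mc1_subproof.
Definition mcM (d e : mc_elt) : mc_elt := MCElt (mcM_subproof d e).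

Definition fracrep := (S * mc_elt)%type.
Implicit Types (p q r : fracrep).

Definition fraceq p q : bool :=
  `[< exists t : mc_elt, mc_val t * p.1 * mc_val q.2 = mc_val t * mc_val p.2 * q.1 >].

Lemma fraceq_refl : reflexive fraceq.
Proof. by move=> p; apply/asboolP; exists mc1 => /=; ring. Qed.

Lemma fraceq_sym : symmetric fraceq.
Proof.
by move=> p q; apply/asboolP/asboolP => -[t e]; exists t;
  rewrite mulrAC -e mulrAC.
Qed.

Lemma fraceq_trans : transitive fraceq.
Proof.
move=> q p r /asboolP[t e] /asboolP[u e']; apply/asboolP.
exists (mcM (mcM t u) q.2) => /=.
transitivity (mc_val u * mc_val r.2 * (mc_val t * p.1 * mc_val q.2)); first by ring.
rewrite e /=.
transitivity (mc_val t * mc_val p.2 * (mc_val u * q.1 * mc_val r.2)); first by ring.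
by rewrite e'; ring.
Qed.

Canonical fraceq_equiv := EquivRel fraceq fraceq_refl fraceq_sym fraceq_trans.

(* The total quotient semiring Q(S): fractions p.1 / p.2 with p.2 cancellable. *)
Definition totquot := {eq_quot fraceq}.

HB.instance Definition _ : EqQuotient _ fraceq totquot := EqQuotient.on totquot.
HB.instance Definition _ := Choice.on totquot.

Definition to_totquot : S -> totquot := fun s => \pi_totquot (s, mc1).

Definition frac_add p q : fracrep :=
  (p.1 * mc_val q.2 + mc_val p.2 * q.1, mcM p.2 q.2).
Definition totquot_add := lift_op2 totquot frac_add.

Definition frac_mul p q : fracrep := (p.1 * q.1, mcM p.2 q.2).
Definition totquot_mul := lift_op2 totquot frac_mul.

Lemma fraceq_repr p :
  exists t : mc_elt, mc_val t * p.1 * mc_val (repr (\pi_totquot p)).2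
                   = mc_val t * mc_val p.2 * (repr (\pi_totquot p)).1.
Proof.
apply/asboolP; have : p == repr (\pi_totquot p) %[mod totquot] by rewrite reprK.
by rewrite eqmodE.
Qed.

Lemma pi_totquot_add : {morph \pi_totquot : p q / frac_add p q >-> totquot_add p q}.
Proof.
move=> p q; unlock totquot_add; apply/eqmodP/asboolP => /=.
have [t e] := fraceq_repr p; have [u e'] := fraceq_repr q.
set p' := repr (\pi p) in e *; set q' := repr (\pi q) in e' *.
exists (mcM t u) => /=.
transitivity ((mc_val t * p.1 * mc_val p'.2) * mc_val u * mc_val q.2 * mc_val q'.2
  + (mc_val u * q.1 * mc_val q'.2) * mc_val t * mc_val p.2 * mc_val p'.2); first by ring.
by rewrite e e'; ring.
Qed.
Canonical pi_totquot_add_morph := PiMorph2 pi_totquot_add.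

Lemma pi_totquot_mul : {morph \pi_totquot : p q / frac_mul p q >-> totquot_mul p q}.
Proof.
move=> p q; unlock totquot_mul; apply/eqmodP/asboolP => /=.
have [t e] := fraceq_repr p; have [u e'] := fraceq_repr q.
set p' := repr (\pi p) in e *; set q' := repr (\pi q) in e' *.
exists (mcM t u) => /=.
transitivity ((mc_val t * p.1 * mc_val p'.2) * (mc_val u * q.1 * mc_val q'.2));
  first by ring.
by rewrite e e'; ring.
Qed.
Canonical pi_totquot_mul_morph := PiMorph2 pi_totquot_mul.

Lemma fraceqI p q :
  p.1 * mc_val q.2 = mc_val p.2 * q.1 -> \pi_totquot p = \pi_totquot q.
Proof. by move=> e; apply/eqmodP/asboolP; exists mc1 => /=; rewrite !mul1r. Qed.

Lemma totquot_addA : associative totquot_add.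
Proof.
elim/quotW=> p; elim/quotW=> q; elim/quotW=> r; rewrite !piE.
by apply: fraceqI => /=; ring.
Qed.

Lemma totquot_addC : commutative totquot_add.
Proof.
by elim/quotW=> p; elim/quotW=> q; rewrite !piE; apply: fraceqI => /=; ring.
Qed.

Lemma totquot_add0 : left_id (to_totquot 0) totquot_add.
Proof.
by elim/quotW=> p; rewrite /to_totquot !piE; apply: fraceqI => /=; ring.
Qed.

Lemma totquot_mulA : associative totquot_mul.
Proof.
elim/quotW=> p; elim/quotW=> q; elim/quotW=> r; rewrite !piE.
by apply: fraceqI => /=; ring.
Qed.

Lemma totquot_mulC : commutative totquot_mul.
Proof.
by elim/quotW=> p; elim/quotW=> q; rewrite !piE; apply: fraceqI => /=; ring.
Qed.

Lemma totquot_mul1 : left_id (to_totquot 1) totquot_mul.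
Proof.
by elim/quotW=> p; rewrite /to_totquot !piE; apply: fraceqI => /=; ring.
Qed.

Lemma totquot_mulDl : left_distributive totquot_mul totquot_add.
Proof.
elim/quotW=> p; elim/quotW=> q; elim/quotW=> r; rewrite !piE.
by apply: fraceqI => /=; ring.
Qed.

Lemma totquot_mul0 : left_zero (to_totquot 0) totquot_mul.
Proof.
by elim/quotW=> p; rewrite /to_totquot !piE; apply: fraceqI => /=; ring.
Qed.

Lemma totquot_1neq0 : to_totquot 1 != to_totquot 0.
Proof.
apply/negP; rewrite /to_totquot eqmodE => /asboolP[t] /=.
rewrite -!mulrA => /mc_eltP; rewrite !mul1r => /eqP.
by rewrite oner_eq0.
Qed.

HB.instance Definition _ := GRing.isNmodule.Build totquot
  totquot_addA totquot_addC totquot_add0.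
HB.instance Definition _ := GRing.Nmodule_isComNzSemiRing.Build totquot
  totquot_mulA totquot_mulC totquot_mul1 totquot_mulDl totquot_mul0
  totquot_1neq0.

End TotalQuotient.

Section Fractional.
Variable S : comNzSemiRingType.
Implicit Types I J : set (totquot S).

Definition fractional_ideal I : Prop :=
  [/\ I !=set0,
      forall x y, I x -> I y -> I (x + y),
      forall (s : S) x, I x -> I (to_totquot s * x)
    & exists2 d : S, mult_cancellable d
        & forall x, I x -> range (@to_totquot S) (to_totquot d * x)].

Definition invertible I : Prop :=
  exists2 J, fractional_ideal J & ideal_mul I J = range (@to_totquot S).

Definition prufer_semiring : Prop :=
  forall I : set S, is_ideal I -> fin_gen I -> I <> [set 0] ->
    invertible (@to_totquot S @` I).

End Fractional.

Arguments subtractive_semiring : clear implicits.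
Arguments semidomain : clear implicits.
Arguments gaussian_semiring : clear implicits.
Arguments prufer_semiring : clear implicits.

(* Main.v *)
Require Import Defs.
From mathcomp Require Import all_boot all_order all_algebra.
From mathcomp Require Import generic_quotient.
From mathcomp Require Import boolp classical_sets.
From mathcomp Require Import ring.

(** The implications are proved in a cycle, none of them with more than the
ideal calculus of a commutative semiring and a few coefficient comparisons.

(1) => (2): if [1] is a sum of products [a_i b_i] with [a_i] in [I] and [b_i]
in its inverse, multiplying [y] in [J] by this sum shows that [I J <= I K]
forces [y] into [K] ([invertible_mulI]).  (2) => (3): [I] times [[IJ : I]] is
[I J], so [I] can be cancelled ([cancellation_residual]).

(3) => (4): write [H] for [c(fg)], let [f_m], [g_n] be the top coefficients
and [f'], [g'] the polynomials left without their top terms.  One proves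
[c(f) c(g) <= H] by induction on the sizes.  The product [f_m g_n] is a
coefficient of [f g].  By subtractivity [c(fg') <= H + g_n c(f)], so the
induction hypothesis for [(f, g')] gives [f_m c(f) c(g') <= H c(f)], and (3)
cancels [c(f)], whence [f_m c(g) <= H].  By subtractivity again
[c(f'g) <= H], and the induction hypothesis for [(f', g)] concludes
([residual_gaussian_coef]).

(4) => (1): from [ab = r a^2 + s b^2] one wants [sb] to be a multiple of [a].
In a ring this says that [sb / a], a root of [Y^2 - Y + rs], is integral over
a domain that is integrally closed.  The root is recovered from contents
without any subtraction: with [B = sb],
  [(a X + B) (B X + rs a) = a B (X^2 + X + rs)],
so the Gaussian property puts [B^2] into [(a B)] ([gaussian_integral]).
Then [b = ra + tb], and subtractivity of [(b)] splits [1 = v + t] with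
[v b] in [(a)] and [t a] in [(b)] ([comparable_split]): locally, any two
elements are comparable for divisibility.  It follows that every finitely
generated ideal is locally principal, in the form that the multipliers
[w] with [w I <= (a)] for some generator [a] together generate the unit ideal
([principal_locus_full]); the fractions [w / a] then exhibit an inverse of
[I] ([split_prufer]). *)

Set Implicit Arguments.
Unset Strict Implicit.
Unset Printing Implicit Defensive.

Import GRing.Theory.
Local Open Scope ring_scope.
Local Open Scope quotient_scope.
Local Open Scope classical_set_scope.

(** * Ideals of a commutative semiring *)

Section IdealCalculus.
Variable S : comNzSemiRingType.
Implicit Types (I J K A : set S) (a b s x : S) (f g : {poly S}).

Lemma ideal0 I : is_ideal I -> I 0.
Proof. by case=> -[a Ia] _ /(_ 0 _ Ia); rewrite mul0r. Qed.

Lemma ideal_sum I (T : Type) (r : seq T) (P : pred T) (F : T -> S) :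
  is_ideal I -> (forall i, P i -> I (F i)) -> I (\sum_(i <- r | P i) F i).
Proof.
move=> idI IF; apply: big_ind => //; first exact: ideal0.
by case: idI.
Qed.

Definition principal a : set S := [set x | exists s, x = s * a].

Lemma principal_ideal a : is_ideal (principal a).
Proof.
split; first by exists a, 1; rewrite mul1r.
  by move=> _ _ [s ->] [t ->]; exists (s + t); rewrite mulrDl.
by move=> s _ [t ->]; exists (s * t); rewrite mulrA.
Qed.

Lemma ideal_gen_ideal A : is_ideal (ideal_gen A).
Proof.
split; first by exists 0 => I [idI _]; exact: ideal0.
  by move=> a b Ia Ib I [idI AI]; case: (idI) => _ + _; apply;
    [apply: Ia | apply: Ib].
by move=> s a Ia I [idI AI]; case: (idI) => _ _; apply; apply: Ia.
Qed.

Lemma ideal_gen_min A I : is_ideal I -> A `<=` I -> ideal_gen A `<=` I.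
Proof. by move=> idI AI; exact: smallest_sub. Qed.

Lemma mem_ideal_gen A a : A a -> ideal_gen A a.
Proof. by move=> Aa; exact: (@sub_smallest _ (@is_ideal S) A A). Qed.

(** Membership in the colon ideal [I : a] can be tested on generators; this
plays the part of reasoning with products of ideals by single elements. *)
Lemma ideal_gen_minM A I a : is_ideal I -> (forall x, A x -> I (x * a)) ->
  forall x, ideal_gen A x -> I (x * a).
Proof.
move=> idI AI x; case: (idI) => _ ID IZ.
suff idK : is_ideal [set x | I (x * a)] by exact: (ideal_gen_min idK).
split=> [|y z Iy Iz|s y Iy] /=.
  by exists 0; rewrite /= mul0r; exact: ideal0.
  by rewrite mulrDl; exact: ID.
by rewrite -mulrA; exact: IZ.
Qed.

Lemma ideal_gen2P a b x :
  ideal_gen [set a; b] x -> exists r s, x = r * a + s * b.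
Proof.
suff idK : is_ideal [set x | exists r s, x = r * a + s * b].
  apply: (ideal_gen_min idK) => y /= [] ->.
    by exists 1, 0; rewrite mul1r mul0r addr0.
  by exists 0, 1; rewrite mul1r mul0r add0r.
split; first by exists a, 1, 0; rewrite mul1r mul0r addr0.
  by move=> _ _ [r [s ->]] [r' [s' ->]]; exists (r + r'), (s + s'); ring.
by move=> t _ [r [s ->]]; exists (t * r), (t * s); ring.
Qed.

Lemma mem_ideal_mul I J a b : I a -> J b -> ideal_mul I J (a * b).
Proof.
move=> Ia Jb; exists 1, (fun=> a), (fun=> b); split=> //.
by rewrite big_ord1.
Qed.

Lemma ideal_mul0 I J : ideal_mul I J 0.
Proof.
by exists 0, (fun=> 0), (fun=> 0); split=> [[]|[]|] //; rewrite big_ord0.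
Qed.

Lemma ideal_mulD I J x y :
  ideal_mul I J x -> ideal_mul I J y -> ideal_mul I J (x + y).
Proof.
move=> [m [a [b [Ia Jb ->]]]] [n [c [d [Ic Jd ->]]]].
exists (m + n)%N, (fun i => match split i with inl k => a k | inr k => c k end),
  (fun i => match split i with inl k => b k | inr k => d k end).
split=> [i|i|]; do ?by case: split.
rewrite big_split_ord /=; congr (_ + _); apply: eq_bigr => i _.
  by rewrite -[lshift n i]/(unsplit (inl i)) unsplitK.
by rewrite -[rshift m i]/(unsplit (inr i)) unsplitK.
Qed.

Lemma ideal_mulZ I J s x : (forall a, I a -> I (s * a)) ->
  ideal_mul I J x -> ideal_mul I J (s * x).
Proof.
move=> sI [m [a [b [Ia Jb ->]]]]; exists m, (fun i => s * a i), b.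
split=> // [i|]; first exact: sI.
by rewrite mulr_sumr; apply: eq_bigr => i _; rewrite mulrA.
Qed.

Lemma ideal_mul_ideal I J : is_ideal I -> is_ideal (ideal_mul I J).
Proof.
move=> [_ _ IZ]; split=> [|x y|s x]; first by exists 0; exact: ideal_mul0.
  exact: ideal_mulD.
by apply: ideal_mulZ; exact: IZ.
Qed.

Lemma ideal_mul_min I J K : is_ideal K ->
  (forall a b, I a -> J b -> K (a * b)) -> ideal_mul I J `<=` K.
Proof.
move=> idK IJK _ [m [a [b [Ia Jb ->]]]].
by apply: ideal_sum => // i _; exact: IJK.
Qed.

Lemma residual_ideal I J : is_ideal I -> is_ideal (residual I J).
Proof.
move=> idI; case: (idI) => _ ID IZ; split.
- by exists 0 => x _; rewrite mul0r; exact: ideal0.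
- by move=> a b Ia Ib x Jx; rewrite mulrDl; apply: ID; [exact: Ia | exact: Ib].
- by move=> s a Ia x Jx; rewrite -mulrA; apply: IZ; exact: Ia.
Qed.

(** The ideals [J] and [[IJ : I]] have the same product with [I], because
[I J <= I [IJ : I] <= I J]. *)
Lemma cancellation_residual I J : cancellation_ideal I -> is_ideal J ->
  residual (ideal_mul I J) I = J.
Proof.
move=> [idI _ canI] idJ.
have idIJ := ideal_mul_ideal J idI.
have JR : J `<=` residual (ideal_mul I J) I.
  by move=> y Jy x Ix; rewrite mulrC; exact: mem_ideal_mul.
apply: canI => //; first exact: residual_ideal.
apply/seteqP; split.
  by apply: ideal_mul_min => // a b Ia; rewrite mulrC; apply.
apply: ideal_mul_min; first exact: ideal_mul_ideal.
by move=> a b Ia Jb; apply: mem_ideal_mul => //; exact: JR.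
Qed.

Lemma mem_content f i : content f f`_i.
Proof. by apply: mem_ideal_gen; exists i. Qed.

Lemma content_ideal f : is_ideal (content f).
Proof. exact: ideal_gen_ideal. Qed.

Lemma content_min f I : is_ideal I -> (forall i, I f`_i) -> content f `<=` I.
Proof. by move=> idI If; apply: ideal_gen_min => // _ [i _ <-]. Qed.

Lemma content_minM f I a : is_ideal I -> (forall i, I (f`_i * a)) ->
  forall x, content f x -> I (x * a).
Proof. by move=> idI If; apply: ideal_gen_minM => // _ [i _ <-]. Qed.

Lemma content_fin_gen f : fin_gen (content f).
Proof.
exists (polyseq f); apply/seteqP; split.
  apply: content_min; first exact: ideal_gen_ideal.
  move=> i; have [ltif|leif] := ltnP i (size f).
    by apply: mem_ideal_gen; exact: mem_nth.
  by rewrite nth_default //; exact: ideal0 (ideal_gen_ideal _).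
apply: ideal_gen_min; first exact: content_ideal.
by move=> x /= /(nthP 0)[i _ <-]; exact: mem_content.
Qed.

Lemma content_mul_sub f g :
  content (f * g) `<=` ideal_mul (content f) (content g).
Proof.
have idfg := ideal_mul_ideal (content g) (content_ideal f).
apply: content_min => // k; rewrite coefM; apply: ideal_sum => // i _.
by apply: mem_ideal_mul; exact: mem_content.
Qed.

Lemma gaussian_by_coef :
  (forall f g i j, content (f * g) (f`_i * g`_j)) -> gaussian_semiring S.
Proof.
move=> fgH f g; apply/seteqP; split; first exact: content_mul_sub.
have idH := content_ideal (f * g).
apply: ideal_mul_min => // a b fa gb.
apply: (content_minM idH _ fa) => i; rewrite [_ * b]mulrC.
by apply: (content_minM idH _ gb) => j; rewrite [_ * f`_i]mulrC.
Qed.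

End IdealCalculus.

(** * Cancelling contents makes a subtractive semiring Gaussian *)

Section ResidualGaussian.
Variable S : comNzSemiRingType.
Implicit Types (I J : set S) (f g : {poly S}).

Lemma poly_peel_lead n f : (size f <= n.+1)%N ->
  f = take_poly n f + f`_n *: 'X^n.
Proof.
move=> sf; apply/polyP => i; rewrite coefD coef_take_poly coefZ coefXn.
case: (ltngtP i n) => [_|ltni|->]; rewrite ?mulr0 ?mulr1 ?addr0 ?add0r //.
by rewrite nth_default // (leq_trans sf).
Qed.

Lemma coefM_top m n f g : (size f <= m.+1)%N -> (size g <= n.+1)%N ->
  (f * g)`_(m + n) = f`_m * g`_n.
Proof.
move=> sf sg; rewrite coefM (bigD1 (inord m)) //= inordK ?ltnS ?leq_addr //.
rewrite addKn big1 ?addr0 // => i; rewrite -val_eqE /= inordK ?ltnS ?leq_addr //.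
case: (ltngtP i m) => // [ltim|ltmi] _.
  rewrite [g`__]nth_default ?mulr0 //; apply: leq_trans sg _.
  by rewrite ltn_subRL ltn_add2r.
by rewrite nth_default ?mul0r //; exact: leq_trans sf _.
Qed.

Hypothesis hsub : subtractive_semiring S.
Hypothesis hres : forall I J, is_ideal I -> fin_gen I -> I <> [set 0] ->
  is_ideal J -> fin_gen J -> residual (ideal_mul I J) I = J.

(** The sizes are bounded rather than fixed, because removing the top term may
lower the size by more than one.  The induction hypothesis is used for
[(f, g')], which bounds the row [f_m g_j], and then for [(f', g)], which bounds
all other products. *)
Lemma residual_gaussian_coef m n f g : (size f <= m)%N -> (size g <= n)%N ->
  forall i j, content (f * g) (f`_i * g`_j).
Proof.
elim: m n f g => [|m IHm] n f g.
  rewrite leqn0 size_poly_eq0 => /eqP -> _ i j.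
  by rewrite mul0r coef0 mul0r; exact: ideal0 (content_ideal _).
elim: n g => [|n IHn] g sf.
  rewrite leqn0 size_poly_eq0 => /eqP -> i j.
  by rewrite mulr0 coef0 mulr0; exact: ideal0 (content_ideal _).
move=> sg; set H := content (f * g).
have idH : is_ideal H := content_ideal _.
have [cf0 i j|cfN0] := pselect (content f = [set 0]).
  have : content f f`_i by exact: mem_content.
  rewrite cf0 => /= ->.
  by rewrite mul0r; exact: ideal0.
have idcf := content_ideal f.
have idfH := ideal_mul_ideal H idcf.
have fE := poly_peel_lead sf; have gE := poly_peel_lead sg.
set f' := take_poly m f in fE; set g' := take_poly n g in gE.
have topH : H (f`_m * g`_n) by rewrite -coefM_top //; exact: mem_content.
(* Multiplied by any element of the content of f, the product f_m g_j falls in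
   c(f) H; the hypothesis on residuals then removes the factor c(f). *)
have leadH j : H (f`_m * g`_j).
  have [leqj|ltjn] := leqP n j.
    have [<- //|nj] := eqVneq n j.
    rewrite [g`_j]nth_default ?mulr0; first exact: ideal0.
    by apply: leq_trans sg _; rewrite ltn_neqAle nj.
  rewrite -(hres idcf (content_fin_gen f) cfN0 idH (content_fin_gen (f * g))).
  move=> x fx; rewrite mulrC; apply: (content_minM idfH _ fx) => k.
  have := IHn g' sf (size_take_poly n g) k j; rewrite coef_take_poly ltjn => fgk.
  rewrite mulrCA mulrC; apply: (content_minM idfH _ fgk) => l.
  (* (fg)_l = (fg')_l + f_(l-n) g_n, and both the left side and the last term
     lie in c(f) H once multiplied by f_m. *)
  apply: (hsub idfH (a := (f * (g`_n *: 'X^n))`_l * f`_m)).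
    rewrite -mulrDl -coefD -mulrDr addrC -gE mulrC.
    by apply: mem_ideal_mul; exact: mem_content.
  rewrite -scalerAr coefZ coefMXn; case: ifP => _; rewrite ?mulr0 ?mul0r.
    exact: ideal0.
  rewrite mulrAC mulrC [g`_n * _]mulrC; apply: mem_ideal_mul => //.
  exact: mem_content.
move=> i j; have [leim|ltim] := leqP m i.
  have [<- //|ni] := eqVneq m i.
  rewrite nth_default ?mul0r; first exact: ideal0.
  by apply: leq_trans sf _; rewrite ltn_neqAle ni.
have := IHm n.+1 f' g (size_take_poly m f) sg i j.
rewrite coef_take_poly ltim; move: (f`_i * g`_j); apply: content_min => // l.
(* (fg)_l = (f'g)_l + f_m g_(l-m), where the last term lies in H by leadH. *)
apply: (hsub idH (a := (f`_m *: 'X^m * g)`_l)).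
  by rewrite -coefD -mulrDl addrC -fE; exact: mem_content.
rewrite -scalerAl coefZ coefXnM; case: ifP => _; last exact: leadH.
by rewrite mulr0; exact: ideal0.
Qed.

Lemma residual_gaussian : gaussian_semiring S.
Proof.
apply: gaussian_by_coef => f g i j.
exact: residual_gaussian_coef (leqnn _) (leqnn _) _ _.
Qed.

End ResidualGaussian.

(** * Invertible ideals are cancellation ideals *)

Section Fractions.
Variable S : comNzSemiRingType.
Implicit Types (I J K : set S) (a b s w x y : S).
Local Notation iota := (@to_totquot S).

Lemma to_totquotD : {morph iota : x y / x + y}.
Proof.
by move=> x y; rewrite /to_totquot -[RHS]/(totquot_add _ _) !piE;
  apply: fraceqI => /=; ring.
Qed.

Lemma to_totquotM : {morph iota : x y / x * y}.
Proof.
by move=> x y; rewrite /to_totquot -[RHS]/(totquot_mul _ _) !piE;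
  apply: fraceqI => /=; ring.
Qed.

Lemma to_totquot_sum (T : Type) (r : seq T) (P : pred T) (F : T -> S) :
  iota (\sum_(i <- r | P i) F i) = \sum_(i <- r | P i) iota (F i).
Proof. exact: (big_morph iota to_totquotD erefl). Qed.

Lemma to_totquot_inj : injective iota.
Proof.
move=> x y /eqmodP/asboolP[t] /=; rewrite -!mulrA => /mc_eltP.
by rewrite mulr1 mul1r.
Qed.

Lemma frac_mul_to_totquot w (d : mc_elt S) x y :
  w * x = y * mc_val d -> \pi_(totquot S) (w, d) * iota x = iota y.
Proof.
move=> e; rewrite /to_totquot -[LHS]/(totquot_mul _ _) !piE.
by apply: fraceqI => /=; rewrite mulr1 e; ring.
Qed.

Lemma range_to_totquotM s (z : totquot S) :
  range iota z -> range iota (iota s * z).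
Proof. by case=> x _ <-; exists (s * x) => //; rewrite to_totquotM. Qed.

Lemma range_to_totquotD (y z : totquot S) :
  range iota y -> range iota z -> range iota (y + z).
Proof.
by case=> x _ <- [x' _ <-]; exists (x + x') => //; rewrite to_totquotD.
Qed.

(** With [1 = \sum_i a_i b_i] the decomposition of the unit in [I D], where
[D] is the inverse of [I], each [a_i y] is a sum of products [c_l k_l] from
[I K], and [b_i c_l] lies in [S]; so [a_i b_i y] lies in [K], and [y] is the
sum of these. *)
Lemma invertible_mulI I J K : invertible (iota @` I) -> is_ideal K ->
  ideal_mul I J `<=` ideal_mul I K -> J `<=` K.
Proof.
move=> [D _ ID] idK IJK y Jy.
have [n [a [b [Ia Db e]]]] : ideal_mul (iota @` I) D (iota 1).
  by rewrite ID; exists 1.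
have idk i : exists k, K k /\ iota k = a i * b i * iota y.
  have [x Ix ax] := Ia i.
  have [m [c [k [Ic Kk xyE]]]] := IJK _ (mem_ideal_mul Ix Jy).
  have sk l : exists s, iota s = iota (c l) * b i.
    have : range iota (iota (c l) * b i).
      by rewrite -ID; apply: mem_ideal_mul => //; exists (c l).
    by case=> s _ <-; exists s.
  have [s sE] := choice sk.
  exists (\sum_(l < m) s l * k l); split.
    by apply: ideal_sum => // l _; case: idK => _ _; apply.
  rewrite mulrAC -ax -to_totquotM xyE !to_totquot_sum mulr_suml.
  by apply: eq_bigr => l _; rewrite !to_totquotM sE mulrAC.
have [k kP] := choice idk.
suff -> : y = \sum_(i < n) k i.
  by apply: ideal_sum => // i _; case: (kP i).
apply: to_totquot_inj; rewrite to_totquot_sum -[LHS]mul1r.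
rewrite -[1]/(iota 1) e mulr_suml; apply: eq_bigr => i _.
by case: (kP i).
Qed.

Lemma invertible_cancellation I : is_ideal I -> I <> [set 0] ->
  invertible (iota @` I) -> cancellation_ideal I.
Proof.
move=> idI IN0 invI; split=> // J K idJ idK e; apply/seteqP.
by split; apply: (invertible_mulI invI); rewrite // e.
Qed.

End Fractions.

(** * Gaussian subtractive semidomains with [ab] in [(a^2, b^2)] are Prüfer *)

Section GaussianPrufer.
Variable S : comNzSemiRingType.
Implicit Types (a b c r s t v w x y : S).
Local Notation iota := (@to_totquot S).

(** The quotient [y = b / a] satisfies [y = c + y^2].  Over a ring, [X^2 + X + c]
would factor as [(X + y) (X + (1 - y))]; here [1 - y] is replaced by [c / y],
which also makes the two constants add up to [1], and clearing denominators
gives polynomials over [S] whose contents both contain [b]. *)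
Lemma gaussian_integral a b c : gaussian_semiring S -> semidomain S ->
  a * b = c * a ^+ 2 + b ^+ 2 -> exists t, b = t * a.
Proof.
move=> gauss dom e; have [->|b0] := eqVneq b 0.
  by exists 0; rewrite mul0r.
pose f := a%:P * 'X + b%:P; pose g := b%:P * 'X + (c * a)%:P.
have fgE : f * g = (a * b)%:P * ('X^2 + 'X + c%:P).
  have eP : a%:P * b%:P = c%:P * a%:P ^+ 2 + b%:P ^+ 2 :> {poly S}.
    by rewrite -polyCM e polyCD polyCM !polyC_exp.
  rewrite /f /g !polyCM.
  transitivity (a%:P * b%:P * 'X^2 + (c%:P * a%:P ^+ 2 + b%:P ^+ 2) * 'X
                + a%:P * b%:P * c%:P); first by ring.
  by rewrite -eP; ring.
have cfb : content f b.
  have -> : b = f`_0 by rewrite /f coefD coefMX !coefC /= add0r.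
  exact: mem_content.
have cgb : content g b.
  have -> : b = g`_1 by rewrite /g coefD coefMX !coefC /= addr0.
  exact: mem_content.
have := mem_ideal_mul cfb cgb; rewrite -gauss fgE.
have : content ((a * b)%:P * ('X^2 + 'X + c%:P)) `<=` principal (a * b).
  apply: content_min; first exact: principal_ideal.
  by move=> i; rewrite coefCM [_ * _`_i]mulrC; eexists.
move=> /[apply] -[t bb]; exists t; apply: (dom b b0).
by rewrite bb; ring.
Qed.

Hypothesis hsub : subtractive_semiring S.
Hypothesis hdom : semidomain S.

(** Writing [ab = r a^2 + s b^2] and [sb = t a] gives [b = ra + tb].  In a ring
one would take [v = 1 - t]; here subtractivity of the ideal [(b)] gives
[ra = v b], and cancelling [b] yields [v + t = 1]. *)
Lemma comparable_split a b : gaussian_semiring S ->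
  ideal_gen [set a ^+ 2; b ^+ 2] (a * b) ->
  exists v t, [/\ v + t = 1, principal a (v * b) & principal b (t * a)].
Proof.
move=> gauss /ideal_gen2P[r [s e]].
have [->|a0] := eqVneq a 0.
  by exists 0, 1; split; [rewrite add0r | exists 0; rewrite !mul0r
    | exists 0; rewrite mul0r mulr0].
have [->|b0] := eqVneq b 0.
  by exists 1, 0; split; [rewrite addr0 | exists 0; rewrite mul0r mulr0
    | exists 0; rewrite !mul0r].
have [t sbE] : exists t, s * b = t * a.
  apply: (@gaussian_integral a (s * b) (r * s)) => //.
  by transitivity (s * (a * b)); [ring | rewrite e; ring].
have bE : r * a + t * b = b.
  apply: (hdom a0); rewrite e.
  by transitivity (r * a ^+ 2 + t * a * b); [ring | rewrite -sbE; ring].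
have [v raE] : principal b (r * a).
  apply: (hsub (principal_ideal b) (a := t * b)); last by exists t.
  by rewrite addrC bE; exists 1; rewrite mul1r.
exists v, t; split; [|by exists r|by exists s].
by apply: (hdom b0); rewrite mulr1 -[RHS]bE raE; ring.
Qed.

(** The multipliers [w] that send the ideal generated by [r] into a principal
ideal [(a)] with [a] in [r]; over a ring, they cut out the basic open sets of
the spectrum on which that ideal is principal with generator in [r]. *)
Definition principal_locus (r : seq S) : set S :=
  [set w | exists2 a, a \in r & forall x, x \in r -> principal a (w * x)].

Hypothesis split2 : forall a b,
  exists v t, [/\ v + t = 1, principal a (v * b) & principal b (t * a)].

(** When a generator [c] is added, a multiplier [w] towards [(a)] is the sum of
[w v] and [w t], where [v + t = 1] compares [a] and [c]: the first still sends
everything into [(a)], the second sends everything into [(c)]. *)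
Lemma principal_locus_full c (r : seq S) :
  ideal_gen (principal_locus (c :: r)) 1.
Proof.
elim: r c => [|d r IH] c.
  apply: mem_ideal_gen; exists c; rewrite ?mem_head // => x.
  by rewrite inE => /eqP ->; exists 1.
have idW := ideal_gen_ideal (principal_locus [:: c, d & r]).
move: (IH d); apply: ideal_gen_min => // w [a ar wa].
have [v [t [vt1 vc ta]]] := split2 a c.
rewrite -[w]mulr1 -vt1 mulrDr; case: (idW) => _ + _; apply; apply: mem_ideal_gen.
  exists a; first by rewrite inE ar orbT.
  have [_ _ aZ] := principal_ideal a.
  move=> x; rewrite inE => /orP[/eqP ->|xr]; first by rewrite -mulrA; exact: aZ.
  by rewrite mulrAC mulrC; exact/aZ/wa.
exists c; first exact: mem_head.
have [_ _ cZ] := principal_ideal c.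
move=> x; rewrite inE => /orP[/eqP ->|xr]; first by exists (w * t).
have [y wx] := wa x xr.
by rewrite mulrAC wx -mulrA [a * t]mulrC; exact: cZ.
Qed.

(** The inverse is the largest candidate [{z | z I <= S}]; its product with [I]
contains each [w = a (w / a)] with [w I <= (a)], hence contains [1]. *)
Lemma split_prufer : prufer_semiring S.
Proof.
move=> I idI [r Ir] IN0.
have rI x : x \in r -> I x by move=> xr; rewrite Ir; exact: mem_ideal_gen.
have [x0 x0r x0N0] : exists2 x, x \in r & x != 0.
  apply: contrapT => nr; apply: IN0; apply/seteqP; split; last first.
    by move=> _ /= ->; exact: ideal0.
  rewrite Ir; have -> : [set (0 : S)] = principal 0.
    by apply/seteqP; split=> [_ -> | _ [s ->]] /=; [exists 0|]; rewrite mulr0.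
  apply: ideal_gen_min; first exact: principal_ideal.
  move=> x /= xr; have [->|xN0] := eqVneq x 0; last by case: nr; exists x.
  by exists 0; rewrite mul0r.
pose J : set (totquot S) := [set z | forall x, I x -> range iota (z * iota x)].
have JD (y z : totquot S) : J y -> J z -> J (y + z).
  move=> Jy Jz x Ix; rewrite mulrDl.
  by apply: range_to_totquotD; [exact: Jy | exact: Jz].
have JZ (s : S) z : J z -> J (iota s * z).
  by move=> Jz x Ix; rewrite -mulrA; apply: range_to_totquotM; exact: Jz.
exists J.
  split=> //.
    by exists 1 => x Ix; rewrite mul1r; exists x.
  exists x0; first exact: hdom.
  by move=> z Jz; rewrite mulrC; exact/Jz/rI.
apply/seteqP; split.
  move=> _ [n [a [b [Ia Jb ->]]]].
  apply: big_ind => [|y z|i _]; first by exists 0.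
    exact: range_to_totquotD.
  by have [x Ix <-] := Ia i; rewrite mulrC; exact: Jb.
have IJZ s z : ideal_mul (iota @` I) J z -> ideal_mul (iota @` I) J (iota s * z).
  apply: ideal_mulZ => _ [x Ix <-]; exists (s * x); last exact: to_totquotM.
  by case: idI => _ _; apply.
suff one : ideal_mul (iota @` I) J (iota 1).
  by move=> _ [s _ <-]; rewrite -[s]mulr1 to_totquotM; exact: IJZ.
have [c [q rE]] : exists c q, r = c :: q.
  by case: (r) x0r => // c q _; exists c, q.
have : ideal_gen (principal_locus r) 1.
  by rewrite rE; exact: principal_locus_full.
suff idT : is_ideal [set w | ideal_mul (iota @` I) J (iota w)].
  apply: (ideal_gen_min idT) => w [a ar wa] /=.
  (* For a = 0 the multiplier w annihilates the nonzero x0, so it is zero. *)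
  have [a0|aN0] := eqVneq a 0.
    have [y] := wa _ x0r; rewrite a0 mulr0 => wx0.
    suff -> : w = 0 by exact: ideal_mul0.
    by apply: (hdom x0N0); rewrite mulr0 mulrC.
  have mca : `[< mult_cancellable a >] by apply/asboolP; exact: hdom.
  pose d := MCElt mca.
  rewrite -(@frac_mul_to_totquot _ w d a w) // mulrC.
  apply: mem_ideal_mul; first by exists a => //; exact: rI.
  move=> x; rewrite Ir => rx.
  have [y wxE] : principal a (w * x).
    rewrite mulrC; apply: (ideal_gen_minM (principal_ideal a) _ rx) => z zr.
    by rewrite mulrC; exact: wa.
  by exists y => //; rewrite (@frac_mul_to_totquot _ w d x y).
split.
- by exists 0; exact: ideal_mul0.
- by move=> y z /= Jy Jz; rewrite to_totquotD; exact: ideal_mulD.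
- by move=> s z /= Jz; rewrite to_totquotM; exact: IJZ.
Qed.

End GaussianPrufer.

Theorem theorem4p5 (S : comNzSemiRingType)
    (hsub : subtractive_semiring S)
    (hdom : semidomain S)
    (hsq : forall a b : S, ideal_gen [set a ^+ 2; b ^+ 2] (a * b)) :
  [<-> prufer_semiring S;
       forall I : set S, is_ideal I -> fin_gen I -> I <> [set 0] ->
         cancellation_ideal I;
       forall I J : set S, is_ideal I -> fin_gen I -> I <> [set 0] ->
         is_ideal J -> fin_gen J -> residual (ideal_mul I J) I = J;
       gaussian_semiring S].
Proof.
tfae.
- move=> pruf I idI fgI IN0.
  by apply: invertible_cancellation => //; exact: pruf.
- move=> canc I J idI fgI IN0 idJ _.
  by apply: cancellation_residual => //; exact: canc.
- by move=> hres; exact: residual_gaussian.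
- move=> gauss; apply: split_prufer => // a b.
  exact: comparable_split.
Qed.
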